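(* Let $\rho_1,\rho_2,u_1,u_2$ be real constants with $\rho_1>0$, $\rho_1+\rho_2>0$, $u_2<0$, and consider the two-shock functions $(\rho,u,p)(t,x)$, $t>0$, $x\in\mathbb{R}$, with constant states $$(\rho,u,p)=\begin{cases}(\rho_1,\;u_1,\;0), & x<(u_1+u_2)t,\\[2pt] \Big(2\rho_1+\rho_2,\;u_1+\frac{\rho_1+\rho_2}{2\rho_1+\rho_2}u_2,\;\frac{\rho_1(\rho_1+\rho_2)}{2\rho_1+\rho_2}u_2^2\Big), & (u_1+u_2)t<x<u_1t,\\[2pt] (\rho_1+\rho_2,\;u_1+u_2,\;0), & x>u_1t.\end{cases}$$ Assume that the gas is polytropic with adiabatic exponent $\gamma$, so that its total energy is $E=\frac12\rho u^2+\frac{p}{\gamma-1}$. Consider either of the two shocks (moving with speed $D=u_1+u_2$ or $D=u_1$ respectively), and let $\gamma$ be the adiabatic exponent determined by the Hugoniot condition for conservation of total energy at that shock, $D\,[E]=[Eu+pu]$. Then $\gamma\to3$ as $\dfrac{\rho_2}{\rho_1}\to0$.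
   Context: Here $[f]=f_+-f_-$ denotes the jump of $f$ across the shock, where $f_\pm$ are the constant values of $f$ on the two sides of the shock. The functions $(\rho,u,p)$ are the solution (in the sense of free particles) of the 1D Riemann problem with data $\rho_0(x)=\rho_1+\rho_2\theta(x)$, $u_0(x)=u_1+u_2\theta(x)$, with $\theta$ the Heaviside function, in the compression case $u_2<0$, for the system $\partial_t\rho+\partial_x(\rho u)=0$, $\partial_t(\rho u)+\partial_x(\rho u^2)+\partial_xp=0$. Polytropic means the state equation $p=A\rho^\gamma$ with constant $A>0$ is assumed, so that the system is supplemented by $\partial_tp+u\,\partial_xp+\gamma p\,\partial_xu=0$; the exponent $\gamma$ is then determined from the Hugoniot condition for the total energy. *)

(* Defs.v *)
From mathcomp Require Import all_boot all_order all_algebra.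
From mathcomp Require Import all_classical all_reals all_analysis.
Set Implicit Arguments.
Unset Strict Implicit.
Unset Printing Implicit Defensive.
Import Order.TTheory GRing.Theory Num.Theory.
Import numFieldNormedType.Exports.
Local Open Scope classical_set_scope.
Local Open Scope ring_scope.

Definition compression_data {R : realType} (rho1 rho2 u2 : R) : Prop :=
  [/\ 0 < rho1, 0 < rho1 + rho2 & u2 < 0].

(* The values chosen on the two shock lines are immaterial: only one-sided
   limits at these lines enter [jump]. *)
Definition two_shock {R : realType} (u1 u2 l m r t x : R) : R :=
  if x < (u1 + u2) * t then l else if x < u1 * t then m else r.

Definition density {R : realType} (rho1 rho2 u1 u2 : R) : R -> R -> R :=
  two_shock u1 u2 rho1 (2 * rho1 + rho2) (rho1 + rho2).

Definition velocity {R : realType} (rho1 rho2 u1 u2 : R) : R -> R -> R :=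
  two_shock u1 u2
    u1 (u1 + (rho1 + rho2) / (2 * rho1 + rho2) * u2) (u1 + u2).

Definition pressure {R : realType} (rho1 rho2 u1 u2 : R) : R -> R -> R :=
  two_shock u1 u2
    0 (rho1 * (rho1 + rho2) / (2 * rho1 + rho2) * u2 ^+ 2) 0.

Definition total_energy {R : realType} (gamma : R) (rho u p : R -> R -> R)
    (t x : R) : R :=
  2^-1 * rho t x * u t x ^+ 2 + p t x / (gamma - 1).

(* [f] = f_+ - f_- at time t across the line x = D t; f is applied to (t, x).
   For f locally constant off the line, the one-sided limits are the constant
   values of f on its two sides. *)
Definition jump {R : realType} (D t : R) (f : R -> R -> R) : R :=
  lim (f t x @[x --> (D * t)^'+]) - lim (f t x @[x --> (D * t)^'-]).

Definition energy_hugoniot {R : realType} (D gamma : R)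
    (rho u p : R -> R -> R) : Prop :=
  let E := total_energy gamma rho u p in
  forall t, 0 < t ->
    D * jump D t E = jump D t (fun s x => E s x * u s x + p s x * u s x).

Inductive shock := LeftShock | RightShock.

Definition shock_speed {R : realType} (s : shock) (u1 u2 : R) : R :=
  match s with LeftShock => u1 + u2 | RightShock => u1 end.

(* gamma <> 1 is what makes p / (gamma - 1) meaningful: division by zero is
   total in the library. *)
Definition adiabatic_exponent {R : realType} (s : shock)
    (rho1 rho2 u1 u2 gamma : R) : Prop :=
  gamma != 1 /\
  energy_hugoniot (shock_speed s u1 u2) gamma
    (density rho1 rho2 u1 u2) (velocity rho1 rho2 u1 u2)
    (pressure rho1 rho2 u1 u2).

(* Main.v *)
Require Import Defs.
From mathcomp Require Import all_boot all_order all_algebra.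
From mathcomp Require Import all_classical all_reals all_analysis.
From mathcomp Require Import ring lra.
Import Order.TTheory GRing.Theory Num.Theory.
Import numFieldNormedType.Exports.
Local Open Scope classical_set_scope.
Local Open Scope ring_scope.

(** The picture is symmetric under exchanging the two shocks.  At each of them
    gas of zero pressure, of density [a] and velocity [w], meets a shock of
    speed [w + d]; if [b] is the density of the unperturbed gas on the far
    side of the other shock, the state behind the shock is

      density [a + b],  velocity [w + b / (a + b) * d],
      pressure [a * b / (a + b) * d ^+ 2],

    with [a = rho1], [b = rho1 + rho2], [d = u2] at the left shock, and with
    [a] and [b] exchanged and [d = - u2] at the right one.  These states
    already balance mass and momentum, so in the energy balance the kinetic
    terms combine with the work of the pressure, and after division by the
    pressure behind the shock and by [d] what remains is
    [(gamma - 1) * b = 2 * a] ([strong_shock_energy_balance]).  So the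
    Hugoniot condition determines [gamma = 1 + 2 * (a / b)]
    ([adiabatic_exponentP]).  In terms of [q = rho2 / rho1] this is
    [1 + 2 / (1 + q)] at the left shock and [1 + 2 * (1 + q)] at the right
    one.  Both depend on [q] alone and are continuous at [q = 0] with value 3,
    so the limit holds however the other constants vary. *)

Lemma two_shock_comp3 (R : realType) (g : R -> R -> R -> R)
    (u1 u2 l l' l'' m m' m'' r r' r'' t x : R) :
  g (two_shock u1 u2 l m r t x) (two_shock u1 u2 l' m' r' t x)
    (two_shock u1 u2 l'' m'' r'' t x)
  = two_shock u1 u2 (g l l' l'') (g m m' m'') (g r r' r'') t x.
Proof. by rewrite /two_shock; case: ifP => // _; case: ifP. Qed.

Lemma jump_near_cst (R : realType) (D t l r : R) (f : R -> R -> R) :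
  (\forall x \near (D * t)^'-, f t x = l) ->
  (\forall x \near (D * t)^'+, f t x = r) ->
  jump D t f = r - l.
Proof.
move=> fl fr; rewrite /jump.
by rewrite (lim_near_cst _ fl) // (lim_near_cst _ fr).
Qed.

(** For [t > 0] and [u2 < 0] the two shock lines are distinct, with the middle
    state between them, so each one-sided neighborhood of a line can be
    shrunk to stay in one of the three sectors. *)
Lemma jump_two_shock (R : realType) (s : shock) (u1 u2 l m r t : R)
    (f : R -> R -> R) :
  u2 < 0 -> 0 < t -> (forall x, f t x = two_shock u1 u2 l m r t x) ->
  jump (shock_speed s u1 u2) t f =
  match s with LeftShock => m - l | RightShock => r - m end.
Proof.
move=> u2_lt0 t_gt0 fE.
have lines : (u1 + u2) * t < u1 * t by rewrite ltr_pM2r // gtrDl.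
case: s => /=; apply: jump_near_cst; near=> x; rewrite fE /two_shock.
- by rewrite ifT //; near: x; exact: nbhs_left_lt.
- rewrite ifF; last by apply/negbTE; rewrite -leNgt ltW.
  by rewrite ifT //; near: x; exact: nbhs_right_lt.
- rewrite ifF; last first.
    by apply/negbTE; rewrite -leNgt; near: x; exact: nbhs_left_ge.
  by rewrite ifT //; near: x; exact: nbhs_left_lt.
- have xr : u1 * t < x by near: x; exact: nbhs_right_gt.
  rewrite ifF; last by apply/negbTE; rewrite -leNgt ltW // (lt_trans lines).
  by rewrite ifF //; apply/negbTE; rewrite -leNgt ltW.
Unshelve. all: by end_near. Qed.

Definition energy_density {R : realType} (gamma rho u p : R) : R :=
  2^-1 * rho * u ^+ 2 + p / (gamma - 1).

Definition energy_flux {R : realType} (gamma rho u p : R) : R :=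
  energy_density gamma rho u p * u + p * u.

(** The fields are functions of [x / t] with constant values in the sectors,
    so the jump condition does not depend on the time and reads as an equation
    between the values on both sides. *)
Lemma energy_hugoniot_two_shock (R : realType) (s : shock)
    (gamma u1 u2 rl rm rr ul um ur pl pm pr : R) :
  u2 < 0 ->
  let D := shock_speed s u1 u2 in
  let e := energy_density gamma in
  let q := energy_flux gamma in
  energy_hugoniot D gamma
    (two_shock u1 u2 rl rm rr) (two_shock u1 u2 ul um ur)
    (two_shock u1 u2 pl pm pr) <->
  match s with
  | LeftShock => D * (e rm um pm - e rl ul pl) = q rm um pm - q rl ul pl
  | RightShock => D * (e rr ur pr - e rm um pm) = q rr ur pr - q rm um pm
  end.
Proof.
move=> u2_lt0 D e q; rewrite /energy_hugoniot.
have jumpE t f (g : R -> R -> R -> R) : 0 < t ->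
    (forall x, f t x = g (two_shock u1 u2 rl rm rr t x)
      (two_shock u1 u2 ul um ur t x) (two_shock u1 u2 pl pm pr t x)) ->
    jump D t f = match s with
      | LeftShock => g rm um pm - g rl ul pl
      | RightShock => g rr ur pr - g rm um pm end.
  move=> t_gt0 fE; apply: jump_two_shock => // x.
  by rewrite fE two_shock_comp3.
split=> [/(_ 1 ltr01) | H t t_gt0].
- by rewrite (jumpE _ _ e) // (jumpE _ _ q) //; case: s {jumpE} @D.
- by rewrite (jumpE _ _ e) // (jumpE _ _ q) //; case: s {jumpE} @D H.
Qed.

(** In the frame of the shock the gas passes at the rate [- a * d]; the
    momentum balance makes the jump of the kinetic energy flux [- p] times the
    mean velocity [(v + w) / 2], and the energy balance becomes
    [p * d / (a + b) * (b / 2 - a / (gamma - 1)) = 0]. *)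
Lemma strong_shock_energy_balance (R : realType) (a b w d gamma : R) :
  0 < a -> 0 < b -> d != 0 -> gamma != 1 ->
  let v := w + b / (a + b) * d in
  let p := a * b / (a + b) * d ^+ 2 in
  (w + d) * (energy_density gamma (a + b) v p - energy_density gamma a w 0)
    = energy_flux gamma (a + b) v p - energy_flux gamma a w 0
  <-> gamma = 1 + 2 * (a / b).
Proof.
move=> a_gt0 b_gt0 d_neq0 gamma_neq1 v p.
have a_neq0 : a != 0 by rewrite gt_eqF.
have b_neq0 : b != 0 by rewrite gt_eqF.
have ab_neq0 : a + b != 0 by rewrite gt_eqF // addr_gt0.
have g_neq0 : gamma - 1 != 0 by rewrite subr_eq0.
have balance :
    (energy_flux gamma (a + b) v p - energy_flux gamma a w 0)
    - (w + d) * (energy_density gamma (a + b) v p - energy_density gamma a w 0)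
    = (a * b * d ^+ 3 / (2 * (a + b) ^+ 2 * (gamma - 1)))
      * ((gamma - 1) * b - 2 * a).
  by rewrite /energy_flux /energy_density /v /p; field; apply/andP.
have coef_neq0 : a * b * d ^+ 3 / (2 * (a + b) ^+ 2 * (gamma - 1)) != 0.
  by rewrite !(mulf_neq0, invr_neq0, expf_neq0, pnatr_eq0).
split=> [E | gammaE].
- have /eqP : (gamma - 1) * b - 2 * a = 0.
    by apply: (mulfI coef_neq0); rewrite -balance E subrr mulr0.
  rewrite subr_eq0 => /eqP gb.
  by rewrite mulrA -gb mulfK // addrC subrK.
- have gb : (gamma - 1) * b = 2 * a by rewrite gammaE; field.
  by apply/esym/eqP; rewrite -subr_eq0 balance gb subrr mulr0.
Qed.

Definition ahead_density {R : realType} (s : shock) (rho1 rho2 : R) : R :=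
  match s with LeftShock => rho1 | RightShock => rho1 + rho2 end.

Definition far_density {R : realType} (s : shock) (rho1 rho2 : R) : R :=
  match s with LeftShock => rho1 + rho2 | RightShock => rho1 end.

Lemma adiabatic_exponentP (R : realType) (s : shock)
    (rho1 rho2 u1 u2 gamma : R) :
  compression_data rho1 rho2 u2 ->
  adiabatic_exponent s rho1 rho2 u1 u2 gamma <->
  gamma = 1 + 2 * (ahead_density s rho1 rho2 / far_density s rho1 rho2).
Proof.
move=> [r1_gt0 r12_gt0 u2_lt0]; rewrite /adiabatic_exponent.
set g := (X in gamma = X).
have g_neq1 : g != 1.
  rewrite /g -subr_eq0 addrC addKr !mulf_neq0 ?invr_neq0 ?pnatr_eq0 //;
    by case: (s); rewrite /= gt_eqF.
have u2_neq0 : u2 != 0 by rewrite lt_eqF.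
have middleE : 2 * rho1 + rho2 = rho1 + (rho1 + rho2) by ring.
suff hugoniotP : gamma != 1 ->
    energy_hugoniot (shock_speed s u1 u2) gamma
      (density rho1 rho2 u1 u2) (velocity rho1 rho2 u1 u2)
      (pressure rho1 rho2 u1 u2) <-> gamma = g.
  by split=> [[/hugoniotP H /H]|gE] //; split; rewrite ?hugoniotP gE.
move=> gamma_neq1; rewrite /density /velocity /pressure.
apply: iff_trans (energy_hugoniot_two_shock _ _ _ _ _ _ _ _ _ _ _ _ _ _ u2_lt0) _.
rewrite /g middleE; case: s {g g_neq1} => /=.
  exact: strong_shock_energy_balance.
(* The gas ahead of the right shock has velocity [u1 + u2], so relative to it
   the shock moves at [- u2]; as this gas lies on the positive side, both
   jumps have the opposite sign. *)
have middle_velocity :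
    u1 + (rho1 + rho2) / (rho1 + (rho1 + rho2)) * u2
    = u1 + u2 + rho1 / (rho1 + rho2 + rho1) * - u2.
  by field; rewrite gt_eqF //; lra.
have middle_pressure :
    rho1 * (rho1 + rho2) / (rho1 + (rho1 + rho2)) * u2 ^+ 2
    = (rho1 + rho2) * rho1 / (rho1 + rho2 + rho1) * (- u2) ^+ 2.
  by rewrite sqrrN (mulrC rho1) (addrC rho1 (rho1 + rho2)).
have [to_g of_g] := strong_shock_energy_balance _ _ _ (u1 + u2) (- u2) gamma
  r12_gt0 r1_gt0 ltac:(by rewrite oppr_eq0) gamma_neq1.
rewrite addrK in to_g of_g.
rewrite middle_velocity middle_pressure (addrC rho1 (rho1 + rho2)).
split=> [E | /of_g E].
  by apply: to_g; rewrite -opprB mulrN E opprB.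
by rewrite -opprB mulrN E opprB.
Qed.

Theorem proposition4p1 (R : realType) (s : shock) :
  (forall rho1 rho2 u1 u2 : R, compression_data rho1 rho2 u2 ->
     exists! gamma : R, adiabatic_exponent s rho1 rho2 u1 u2 gamma) /\
  (forall (I : Type) (F : set_system I) (FF : Filter F)
     (rho1 rho2 u1 u2 gamma : I -> R),
     (\forall i \near F, compression_data (rho1 i) (rho2 i) (u2 i)) ->
     (\forall i \near F,
        adiabatic_exponent s (rho1 i) (rho2 i) (u1 i) (u2 i) (gamma i)) ->
     rho2 i / rho1 i @[i --> F] --> (0 : R) ->
     gamma i @[i --> F] --> (3 : R)).
Proof.
split=> [rho1 rho2 u1 u2 data | I F FF rho1 rho2 u1 u2 gamma data exponent q0].
  exists (1 + 2 * (ahead_density s rho1 rho2 / far_density s rho1 rho2)).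
  split=> [|gamma]; first exact/adiabatic_exponentP.
  by move=> /(adiabatic_exponentP _ _ _ _ _ _ _ data) ->.
pose ratio (q : R) :=
  match s with LeftShock => (1 + q)^-1 | RightShock => 1 + q end.
have ratio_cvg : ratio (rho2 i / rho1 i) @[i --> F] --> (1 : R).
  have q1 : 1 + rho2 i / rho1 i @[i --> F] --> (1 : R).
    by rewrite -[X in _ --> X]addr0; apply: cvgD => //; exact: cvg_cst.
  rewrite /ratio; case: s {exponent ratio} => //.
  by rewrite -[X in _ --> X]invr1; apply: cvgV => //; exact: oner_neq0.
have -> : (3 : R) = 1 + 2 * 1 by ring.
have lim3 : 1 + 2 * ratio (rho2 i / rho1 i) @[i --> F] --> (1 + 2 * 1 : R).
  by apply: cvgD; [exact: cvg_cst|apply: cvgM => //; exact: cvg_cst].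
apply: cvg_trans lim3; apply: near_eq_cvg; near=> i.
have data_i : compression_data (rho1 i) (rho2 i) (u2 i) by near: i.
have [r1_gt0 r12_gt0 _] := data_i.
have -> : gamma i = 1 + 2 * (ahead_density s (rho1 i) (rho2 i)
                             / far_density s (rho1 i) (rho2 i)).
  by apply/(adiabatic_exponentP _ _ _ _ (u1 i) _ _ data_i); near: i.
have r1_neq0 : rho1 i != 0 by rewrite gt_eqF.
have r12_neq0 : rho1 i + rho2 i != 0 by rewrite gt_eqF.
congr (1 + 2 * _).
have qE : 1 + rho2 i / rho1 i = (rho1 i + rho2 i) / rho1 i.
  by rewrite mulrDl divff.
by rewrite /ratio qE; case: (s) => //=; rewrite invf_div.
Unshelve. all: by end_near. Qed.
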